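(* Let $\mathcal{H}=\{rrb,bby,rby\}$. Then, as $n\to\infty$, $h_2(n,\mathcal{H})=\Theta(n^{2/3})$.
   Context: Edge-colorings of the complete graph $K_n$ use colors from $\{r,b,y\}$ (red, blue, yellow); they need not be proper, and not all colors need be used. A pattern is an edge-colored triangle, denoted by the multiset of the colors of its three edges; e.g. $rrb$ is the triangle with two red edges and one blue edge, $bby$ has two blue edges and one yellow edge, and $rby$ is the rainbow triangle with one edge of each color. For a family $\mathcal{H}$ of patterns, $\operatorname{Forb}(n,\mathcal{H})$ is the set of all edge-colorings of $K_n$ with colors from $\{r,b,y\}$ in which no triangle has a coloring belonging to $\mathcal{H}$. For an edge-coloring $c$ of $K_n$, $h_2(c)$ is the maximum $k$ such that there is a set of $k$ vertices whose induced edges use at most two of the three colors. Finally, $h_2(n,\mathcal{H})=\min\{h_2(c): c\in\operatorname{Forb}(n,\mathcal{H})\}$. *)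

(* Defs.v *)
From HB Require Import structures.
From mathcomp Require Import all_boot all_order all_algebra finmap multiset.
From mathcomp Require Import all_classical all_reals all_analysis.

Set Implicit Arguments.
Unset Strict Implicit.
Unset Printing Implicit Defensive.

Inductive color := Red | Blue | Yellow.

Definition option_of_color (x : color) : option bool :=
  match x with
  | Red => Some true
  | Blue => Some false
  | Yellow => None
  end.

Definition color_of_option (o : option bool) : color :=
  match o with
  | Some true => Red
  | Some false => Blue
  | None => Yellow
  end.

Lemma option_of_colorK : cancel option_of_color color_of_option.
Proof. by case. Qed.

HB.instance Definition _ := Finite.copy color (can_type option_of_colorK).

Notation edge n := {e : {set 'I_n} | #|e| == 2}.

(* Not necessarily proper, and not necessarily using all three colors. *)
Definition coloring (n : nat) := {ffun edge n -> color}.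

Definition edges_in (n : nat) (S : {set 'I_n}) : {set edge n} :=
  [set e : edge n | val e \subset S].

Definition pattern := {mset color}%mset.

Definition pattern_on (n : nat) (c : coloring n) (T : {set 'I_n}) : pattern :=
  seq_mset [seq c e | e in edges_in T].

Definition Forb (n : nat) (H : seq pattern) : {set coloring n} :=
  [set c : coloring n |
    [forall (T : {set 'I_n} | #|T| == 3), pattern_on c T \notin H]].

Definition h2_coloring (n : nat) (c : coloring n) : nat :=
  \max_(S : {set 'I_n} | #|c @: edges_in S| <= 2) #|S|.

(* Since h2_coloring c <= n for every c, the unit n of the iterated minimum
   is attained as a spurious value only when Forb n H is empty. *)
Definition h2 (n : nat) (H : seq pattern) : nat :=
  \big[minn/n]_(c in Forb n H) h2_coloring c.

Definition rrb : pattern := seq_mset [:: Red; Red; Blue].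
Definition bby : pattern := seq_mset [:: Blue; Blue; Yellow].
Definition rby : pattern := seq_mset [:: Red; Blue; Yellow].

(* Main.v *)
(** Lower bound: in an allowed coloring, every vertex outside a non-trivial
    blue component is joined to it by yellow edges only, while inside the
    component there is no yellow and red is an equivalence relation.  Let the
    component have s vertices, p red classes and a largest red class of size q,
    so that s <= p q.  The component misses yellow; one vertex from each red
    class of each non-trivial component form a set missing red; the largest red
    classes of all components (isolated vertices included) form a set missing
    blue.  With h := h_2(c) this gives s <= h, sum p <= h and sum q <= h, hence
    sum s <= sqrt h * sum (p + q) / 2 <= h^(3/2) by AM-GM.
    Upper bound: on triples from [m]^3, color an edge yellow, blue or red
    according to whether its ends first differ in the first, second or third
    coordinate.  On a set missing one of the colors, some two of the
    coordinates determine the vertex, so it has at most m^2 elements. *)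

Require Import Defs.
From mathcomp Require Import all_boot all_order all_algebra finmap multiset.
From mathcomp Require Import all_classical all_reals all_analysis.
From mathcomp Require Import zify.
Import Order.TTheory GRing.Theory Num.Theory numFieldNormedType.Exports.

Set Implicit Arguments.
Unset Strict Implicit.
Unset Printing Implicit Defensive.

(** * Integer roots and iterated minima *)

Lemma ceil_root (k n : nat) : 0 < k -> exists m, n <= m ^ k <= 2 ^ k * n.
Proof.
move=> k_gt0.
have: exists m, n <= m ^ k.
  exists n; case: n => [|n]; first by rewrite exp0n.
  by rewrite -{1}[n.+1]expn1 leq_pexp2l.
case/ex_minnP=> -[|m] le_n_m min_m; first by exists 0; rewrite le_n_m exp0n.
exists m.+1; rewrite le_n_m /=.
have lt_m_n : m ^ k < n by rewrite ltnNge; apply/negP => /min_m; rewrite ltnn.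
(* Here [m] is one below the least root. If it is positive, m + 1 <= 2m; the [1] covers m = 0. *)
apply: (@leq_trans (2 ^ k * maxn 1 (m ^ k))); last first.
  by rewrite leq_mul2l geq_max (ltnW lt_m_n) (leq_trans _ lt_m_n) ?orbT.
case: m {le_n_m min_m lt_m_n} => [|m]; first by rewrite exp1n muln_gt0 expn_gt0
  leq_maxl.
apply: (@leq_trans ((2 * m.+1) ^ k)); first by rewrite leq_exp2r //; lia.
by rewrite expnMn leq_mul2l leq_maxr orbT.
Qed.

Lemma bigmin_leq {I : finType} (P : pred I) (F : I -> nat) (n : nat) (i : I) :
  P i -> \big[minn/n]_(j | P j) F j <= F i.
Proof.
move=> Pi; have : i \in index_enum I by rewrite mem_index_enum.
elim: (index_enum I) => // j r IHr; rewrite inE big_cons => /predU1P[<-|/IHr].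
  by rewrite Pi geq_minl.
by case: (P j) => // le_i; apply: leq_trans le_i; rewrite geq_minr.
Qed.

(** * Blue components and red classes *)

Section Structure.

(* [k] is an edge-coloring of the complete graph on [T], with [None] on the
   diagonal. *)
Variables (T : finType) (k : T -> T -> option color).
Hypothesis k_eq : forall u v, (k u v == None) = (u == v).
Hypothesis k_sym : forall u v, k u v = k v u.
Hypothesis no_rrb : forall u v w,
  k u v = Some Red -> k v w = Some Red -> k u w <> Some Blue.
Hypothesis no_bby : forall u v w,
  k u v = Some Blue -> k v w = Some Blue -> k u w <> Some Yellow.
Hypothesis no_rby : forall u v w,
  k u v = Some Red -> k v w = Some Blue -> k u w <> Some Yellow.

Let blue : rel T := fun u v => k u v == Some Blue.
Let compo u := fingraph.root blue u.
Let nonisolated u := [exists v, blue u v].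
(** Red adjacency made reflexive. It is sure to be an equivalence class only for nonisolated [u], as
    triangles with two red edges and a yellow one are allowed. *)
Let red_class u := [set v | (v == u) || (k u v == Some Red)].

Let k_id u : k u u = None.
Proof. by apply/eqP; rewrite k_eq. Qed.

Let blue_sym : symmetric blue.
Proof. by move=> u v; rewrite /blue k_sym. Qed.

Let conn_sym : fingraph.connect_sym blue.
Proof. exact: fingraph.sym_connect_sym. Qed.

Let compoP u v : reflect (compo u = compo v) (connect blue u v).
Proof. exact: (fingraph.rootP conn_sym). Qed.

Let compo_blue u v : blue u v -> compo u = compo v.
Proof. by move=> buv; apply/compoP/fingraph.connect1. Qed.

Let nonisolated_compo u v : compo u = compo v -> nonisolated u = nonisolated v.
Proof.
move/compoP/(@fingraph.closed_connect _ blue [pred u | nonisolated u]); apply.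
move=> {}u {}v buv; rewrite !inE.
apply/existsP/existsP => _; first by exists u; rewrite blue_sym.
by exists v.
Qed.

(** By [no_rby] and [no_bby], the vertices joined to [u] by yellow are closed under blue steps, and
    [u] is not among them. *)
Let compo_not_yellow u v : compo u = compo v -> k u v != Some Yellow.
Proof.
move/compoP/(@fingraph.closed_connect _ blue [pred v | k u v == Some Yellow]).
rewrite !inE k_id => <- // {}v w; rewrite !inE => /eqP bvw.
have step x y : k x y = Some Blue -> k u x = Some Yellow -> k u y = Some Yellow.
  move=> bxy yux; case ky : (k u y) => [[] |] //.
  - have := no_rby ky (etrans (k_sym _ _) bxy).
    by rewrite yux.
  - have := no_bby ky (etrans (k_sym _ _) bxy).
    by rewrite yux.
  - have /eqP := ky; rewrite k_eq => /eqP eq_uy.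
    by move: yux; rewrite eq_uy k_sym bxy.
apply/eqP/eqP; first exact: step.
by apply: step; rewrite k_sym.
Qed.

(** Take a blue edge [u w] and suppose [u v] is red: a red or yellow [w v] completes a forbidden
    triangle, a blue one puts [v] in the component of [u]. *)
Let yellow_across u v :
  nonisolated u -> compo u <> compo v -> k u v = Some Yellow.
Proof.
move=> /existsP[w /eqP buw] neq_uv; case kuv : (k u v) => [[] |] //.
- case kwv : (k w v) => [[] |].
  + have := no_rrb kwv (etrans (k_sym _ _) kuv).
    by rewrite k_sym buw.
  + case: neq_uv; rewrite (compo_blue (introT eqP buw)).
    by apply: compo_blue; rewrite /blue kwv.
  + have := @no_rby v u w (etrans (k_sym _ _) kuv) buw.
    by rewrite k_sym kwv.
  + case: neq_uv; move/eqP: kwv; rewrite k_eq => /eqP <-.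
    by apply: compo_blue; rewrite /blue buw.
- by case: neq_uv; apply: compo_blue; rewrite /blue kuv.
- by case: neq_uv; move/eqP: kuv; rewrite k_eq => /eqP ->.
Qed.

Let red_class_compo u v : nonisolated u -> v \in red_class u -> compo u = compo
  v.
Proof.
move=> nu; rewrite inE => /predU1P[-> //|/eqP ruv].
have [//|/eqP neq_uv] := eqVneq (compo u) (compo v).
by have := yellow_across nu neq_uv; rewrite ruv.
Qed.

(** Two red edges inside a component force the third: blue is excluded by [no_rrb], yellow by
    [compo_not_yellow]. *)
Let red_class_eq u v : nonisolated u -> v \in red_class u -> red_class u =
  red_class v.
Proof.
move=> nu v_u; have euv := red_class_compo nu v_u.
have nv : nonisolated v by rewrite -(nonisolated_compo euv).
have sub x y : nonisolated x -> y \in red_class x -> {subset red_class y <=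
  red_class x}.
  move=> nx yx z zy.
  have ny : nonisolated y by rewrite -(nonisolated_compo (red_class_compo nx
    yx)).
  have exz := etrans (red_class_compo nx yx) (red_class_compo ny zy).
  move: yx zy; rewrite !inE => /predU1P[-> //|/eqP rxy] /predU1P[->|/eqP ryz].
    by rewrite rxy eqxx orbT.
  case kxz : (k x z) => [[] |]; rewrite ?eqxx ?orbT //.
  - by have := no_rrb rxy ryz; rewrite kxz.
  - by have := compo_not_yellow exz; rewrite kxz.
  - by move/eqP: kxz; rewrite k_eq eq_sym => ->.
apply/setP => w; apply/idP/idP; apply: sub => //.
move: v_u; rewrite !inE => /predU1P[->|]; first by rewrite eqxx.
by rewrite k_sym => ->; rewrite orbT.
Qed.

(** [pick] sees only the set, so equal red classes share a representative; the default is never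
    reached. *)
Let red_rep u := odflt u [pick v in red_class u].

Let red_rep_class u : red_rep u \in red_class u.
Proof. by rewrite /red_rep; case: pickP => //= _; rewrite inE eqxx. Qed.

Let red_rep_eq u v : nonisolated u -> v \in red_class u -> red_rep u = red_rep
  v.
Proof.
move=> nu vu; rewrite /red_rep (red_class_eq nu vu).
by case: pickP => //= /(_ v); rewrite !inE eqxx.
Qed.

(** Built from [compo u] alone, hence constant on each component. *)
Let big_red u := [arg max_(v > compo u | compo v == compo u) #|red_class v|].

Let compo_idem u : compo (compo u) = compo u.
Proof. exact: (fingraph.root_root conn_sym). Qed.

Let big_redP u :
  compo (big_red u) = compo u /\
  forall v, compo v = compo u -> #|red_class v| <= #|red_class (big_red u)|.
Proof.
rewrite /big_red; case: arg_maxnP => [|v /eqP ev maxv]; first by rewrite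
  compo_idem.
by split=> // w /eqP; exact: maxv.
Qed.

Let big_red_eq u v : compo u = compo v -> big_red u = big_red v.
Proof. by rewrite /big_red => ->. Qed.

Let red_reps := [set u | nonisolated u && (red_rep u == u)].
(** An isolated vertex is its own [big_red], so it always belongs. *)
Let big_reds := [set u | u \in red_class (big_red u)].

Variable h : nat.
Hypothesis two_colored_le : forall (A : {set T}) col,
  {in A &, forall u v, k u v != Some col} -> #|A| <= h.

Let card_red_reps : #|red_reps| <= h.
Proof.
apply: (@two_colored_le _ Red) => u v.
rewrite !inE => /andP[nu /eqP eu] /andP[nv /eqP ev].
apply/eqP => ruv; have vu : v \in red_class u by rewrite inE ruv eqxx orbT.
have := red_rep_eq nu vu; rewrite eu ev => euv.
by move: ruv; rewrite euv k_id.
Qed.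

(** The ends of a blue edge share a component, hence the same [big_red]; red edges from it to both
    ends would complete [rrb]. *)
Let card_big_reds : #|big_reds| <= h.
Proof.
apply: (@two_colored_le _ Blue) => u v; rewrite !inE => cu cv.
apply/eqP => buv; have euv := compo_blue (introT eqP buv).
move: cu cv; rewrite (big_red_eq euv); set w := big_red v.
case/predU1P=> [euw|/eqP rwu]; case/predU1P=> [evw|/eqP rwv].
- by move: buv; rewrite euw evw k_id.
- by move: rwv; rewrite -euw buv.
- by move: rwu; rewrite -evw k_sym buv.
- by have := @no_rrb u w v (etrans (k_sym _ _) rwu) rwv; rewrite buv.
Qed.

Let card_compo w : #|[set u | nonisolated u & compo u == w]| <= h.
Proof.
apply: (@two_colored_le _ Yellow) => u v.
by rewrite !inE => /andP[_ /eqP eu] /andP[_ /eqP ev]; apply: compo_not_yellow;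
  rewrite eu.
Qed.

(** The component splits by representatives into parts of red classes, none larger than the largest
    class, which lies in [big_reds]. *)
Let card_compo_mul w : #|[set u | nonisolated u & compo u == w]| <=
  #|[set u in red_reps | compo u == w]| * #|[set u in big_reds | compo u == w]|.
Proof.
set S := [set u | _ & _]; rewrite -[#|S|]sum1_card.
rewrite (partition_big red_rep (mem [set u in red_reps | compo u == w])) /=;
  last first.
  move=> u; rewrite !inE => /andP[nu /eqP <-].
  have ru := red_rep_class u; have eu := red_class_compo nu ru.
  by rewrite -eu eqxx -(nonisolated_compo eu) nu -(red_rep_eq nu ru) eqxx.
rewrite -sum_nat_const; apply: leq_sum => b; rewrite !inE => /andP[/andP[nb /eqP
  eb] /eqP bw].
rewrite sum1_card; apply: (@leq_trans #|red_class b|).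
  apply: subset_leq_card; apply/fintype.subsetP => u; rewrite unfold_in /= =>
    /andP[uS /eqP ub].
  move: uS; rewrite inE => /andP[nu /eqP uw].
  have bu : b \in red_class u by rewrite -ub red_rep_class.
  by rewrite -(red_class_eq nu bu) inE eqxx.
have [eF maxF] := big_redP b.
apply: leq_trans (maxF _ erefl) _.
apply: subset_leq_card; apply/fintype.subsetP => u uF.
have nF : nonisolated (big_red b) by rewrite (nonisolated_compo eF).
have eu := red_class_compo nF uF.
rewrite [u \in _]inE [u \in big_reds]inE -eu eF bw eqxx andbT.
by rewrite (@big_red_eq u b) // -eu.
Qed.

Lemma card_structure : #|T| ^ 2 <= 16 * h ^ 3.
Proof.
(* [t] stands in for the square root of [h]: h <= t^2 <= 4h. *)
have [t /andP[le_h_t le_t_h]] := ceil_root h (isT : 0 < 2).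
have sizeE A : #|A : {set T}| = \sum_w #|[set u in A | compo u == w]|.
  rewrite -[LHS]sum1_card (partition_big compo predT) //=.
  by apply: eq_bigr => w _; rewrite -sum1_card; apply: eq_bigl => u; rewrite
    inE.
pose N := [set u | nonisolated u].
have leN : 2 * #|N| <= t * (#|red_reps| + #|big_reds|).
  rewrite !sizeE -big_split /= !big_distrr /=; apply: leq_sum => w _.
  have eS : [set u in N | compo u == w] = [set u | nonisolated u & compo u ==
    w].
    by apply/setP => u; rewrite !inE.
  rewrite eS.
  have := card_compo w; have := card_compo_mul w.
  set s := #|_|; set p := #|_|; set q := #|_| => s_pq s_h.
  (* Squared: 4s^2 <= 4t^2pq <= t^2(p + q)^2, by s <= h <= t^2, s <= pq and AM-GM. *)
  rewrite -(@leq_exp2r _ _ 2) //; apply: (@leq_trans (4 * (t ^ 2 * (p * q)))).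
    by rewrite expnMn leq_mul2l /= leq_mul // (leq_trans s_h).
  by rewrite expnMn mulnCA leq_mul2l; have := nat_AGM2 p q => /leqifP; case:
    eqP; lia.
have leNC : #|~: N| <= #|big_reds|.
  apply: subset_leq_card; apply/fintype.subsetP => u; rewrite !inE => nu.
  have [eF _] := big_redP u.
  suff -> : big_red u = u by rewrite eqxx.
  apply/esym/eqP; apply: contraNT nu => neq.
  (* If [big_red u] differs from [u], the blue path between them has a first edge, at [u]. *)
  have /fingraph.connectP[[|v p] /= ] : connect blue u (big_red u) by
    apply/compoP.
    by move=> _ e; rewrite e eqxx in neq.
  by case/andP=> buv _ _; apply/existsP; exists v.
have := cardsC N; have := card_red_reps; have := card_big_reds => ? ? eT.
(* The total is at most th + h, and h > 0 forces t >= 1. *)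
have leT : #|T| <= 2 * (t * h) by nia.
apply: leq_trans (_ : (2 * (t * h)) ^ 2 <= _); first by rewrite leq_exp2r.
by rewrite !expnMn (expnSr h 2) -/(2 ^ 2 * _); nia.
Qed.

End Structure.

(** * From colored edges to a symmetric function of two vertices *)

Section PairColor.

Variables (n : nat) (c : coloring n).

(** [insub] fails exactly on the diagonal, which yields the [None] required of [k] in the structural
    bound. *)
Definition pair_color (u v : 'I_n) : option color :=
  omap c (insub [set u; v] : option (edge n)).

Lemma pair_color_eq u v : (pair_color u v == None) = (u == v).
Proof.
by rewrite /pair_color; case: insubP => [e|]; rewrite cards2; case: (u == v).
Qed.

Lemma pair_color_sym u v : pair_color u v = pair_color v u.
Proof. by rewrite /pair_color finset.setUC. Qed.

Lemma pair_colorP u v a : pair_color u v = Some a ->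
  u != v /\ exists2 e : edge n, val e = [set u; v] & c e = a.
Proof.
move=> cuv; rewrite -pair_color_eq cuv; split=> //; move: cuv.
by rewrite /pair_color; case: insubP => //= e _ eE [<-]; exists e.
Qed.

Lemma pair_color_edge (e : edge n) u v :
  u != v -> u \in val e -> v \in val e -> pair_color u v = Some (c e).
Proof.
move=> neq ue ve; have eE : [set u; v] = val e.
  by apply/eqP; rewrite eqEcard finset.subUset !finset.sub1set ue ve cards2 neq
    (eqP (valP e)).
by rewrite /pair_color eE valK.
Qed.

(** The edges inside the triangle are enumerated as a permutation of three distinct ones, and
    multisets ignore order. *)
Lemma pattern_on_triangle u v w a b d :
    pair_color u v = Some a -> pair_color v w = Some b ->
    pair_color u w = Some d ->
  pattern_on c [set u; v; w] = seq_mset [:: a; b; d].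
Proof.
move=> /pair_colorP[uv [e1 E1 <-]] /pair_colorP[vw [e2 E2 <-]] /pair_colorP[uw
  [e3 E3 <-]].
rewrite -[[:: c e1; _; _]]/(map c [:: e1; e2; e3]); apply/eq_seq_msetP/perm_map.
have vu : v != u by rewrite eq_sym.
have wu : w != u by rewrite eq_sym.
have wv : w != v by rewrite eq_sym.
apply: uniq_perm; first exact: enum_uniq.
  rewrite /= !inE negb_or -!andbA andbT; apply/and3P; split.
  - apply: contraNneq uw => E; have := finset.set21 u v.
    by rewrite -E1 E E2 !inE (negbTE uv).
  - apply: contraNneq vw => E; have := finset.set22 u v.
    by rewrite -E1 E E3 !inE (negbTE vu).
  - apply: contraNneq vu => E; have := finset.set21 v w.
    by rewrite -E2 E E3 !inE (negbTE vw) orbF.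
move=> e; rewrite mem_enum inE; apply/idP/idP; last first.
  rewrite !inE => /or3P[] /eqP->; rewrite ?E1 ?E2 ?E3; apply/fintype.subsetP =>
    z;
    by rewrite !inE => /orP[] ->; rewrite ?orbT.
move=> e_sub; suff: [\/ val e = val e1, val e = val e2 | val e = val e3].
  by case=> /val_inj->; rewrite !inE eqxx ?orbT.
have /cards2P[x [y [xy eE]]] := valP e; move: e_sub.
rewrite /= eE E1 E2 E3 finset.subUset !finset.sub1set !inE.
case/andP=> /orP[/orP[]|] /eqP xE /orP[/orP[]|] /eqP yE; move: xy; rewrite xE yE
  ?eqxx // => _.
all: by [constructor 1 | constructor 2 | constructor 3 | constructor 1; apply:
  finset.setUC
  | constructor 2; apply: finset.setUC | constructor 3; apply: finset.setUC].
Qed.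

End PairColor.

Lemma ForbP (n : nat) (H : seq pattern) (c : coloring n) :
  reflect (forall u v w a b d, pair_color c u v = Some a ->
             pair_color c v w = Some b -> pair_color c u w = Some d ->
             seq_mset [:: a; b; d] \notin H)
          (c \in Forb n H).
Proof.
rewrite inE; apply: (iffP forall_inP) => [cH u v w a b d cuv cvw cuw | cH S /eqP
  S3].
  rewrite -(pattern_on_triangle cuv cvw cuw); apply: cH.
  have [uv _] := pair_colorP cuv; have [vw _] := pair_colorP cvw.
  have [uw _] := pair_colorP cuw.
  by rewrite finset.setUC cardsU1 !inE cards2 uv !(eq_sym w) (negbTE uw) (negbTE
    vw).
have /card_gt0P[u uS] : 0 < #|S| by rewrite S3.
have /cards2P[v [w [vw SE]]] : #|S :\ u| == 2 by move: S3; rewrite (cardsD1 u)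
  uS add1n => -[->].
have uv : u != v by have := finset.set21 v w; rewrite -SE !inE eq_sym =>
  /andP[].
have uw : u != w by have := finset.set22 v w; rewrite -SE !inE eq_sym =>
  /andP[].
have -> : S = [set u; v; w].
  by rewrite -finset.setUA -SE finset.setD1K.
case cuv : (pair_color c u v) => [a|]; last by move/eqP: cuv; rewrite
  pair_color_eq (negbTE uv).
case cvw : (pair_color c v w) => [b|]; last by move/eqP: cvw; rewrite
  pair_color_eq (negbTE vw).
case cuw : (pair_color c u w) => [d|]; last by move/eqP: cuw; rewrite
  pair_color_eq (negbTE uw).
by rewrite (pattern_on_triangle cuv cvw cuw); apply: cH cuv cvw cuw.
Qed.

Lemma card_color : #|{: color}| = 3.
Proof.
rewrite -[3]/(2.+1) -card_bool -card_option; apply: bij_eq_card.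
by exists color_of_option; [apply: option_of_colorK | case=> [[]|]].
Qed.

Lemma two_colored_card (n : nat) (c : coloring n) (S : {set 'I_n}) :
  reflect (exists col, {in S &, forall u v, pair_color c u v != Some col})
          (#|c @: edges_in S| <= 2).
Proof.
apply: (iffP idP) => [card2 | [col S_col]].
  have : c @: edges_in S != [set: color].
    by apply: contraTneq card2 => ->; rewrite cardsT card_color.
  rewrite -finset.subTset => /subsetPn[col _ col_notin]; exists col => u v uS
    vS.
  apply: contraNneq col_notin => /pair_colorP[_ [e eE <-]].
  by apply: imset_f; rewrite inE eE finset.subUset !finset.sub1set uS.
have card2 : #|predC1 col| = 2 by rewrite cardC1 card_color.
rewrite -[leqRHS]card2; apply: subset_leq_card; apply/fintype.subsetP => a
  /imsetP[e eS ->{a}].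
rewrite !inE; move: eS; rewrite inE.
have /cards2P[x [y [xy eE]]] := valP e.
rewrite eE finset.subUset !finset.sub1set => /andP[xS yS].
apply: contraNneq (S_col x y xS yS) => <-.
by rewrite (@pair_color_edge _ _ e) // eE ?finset.set21 ?finset.set22.
Qed.

(** Replaces equality of multisets by [perm_eq], which computes on explicit lists. *)
Lemma mem_patterns (s : seq color) :
  (seq_mset s \in [:: rrb; bby; rby]) =
  [|| perm_eq s [:: Red; Red; Blue], perm_eq s [:: Blue; Blue; Yellow]
    | perm_eq s [:: Red; Blue; Yellow]].
Proof.
rewrite in_cons in_cons mem_seq1.
by congr [|| _, _ | _]; apply/eqP/idP => /eq_seq_msetP.
Qed.

(** * The lower bound for [h2] *)

Lemma h2_coloring_lower (n : nat) (c : coloring n) :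
  c \in Forb n [:: rrb; bby; rby] -> n ^ 2 <= 16 * h2_coloring c ^ 3.
Proof.
move=> /ForbP cH; rewrite -{1}[n]card_ord.
apply: (@card_structure _ (pair_color c)).
- exact: pair_color_eq.
- exact: pair_color_sym.
- by move=> u v w uv vw uw; have := cH _ _ _ _ _ _ uv vw uw; rewrite
    mem_patterns.
- by move=> u v w uv vw uw; have := cH _ _ _ _ _ _ uv vw uw; rewrite
    mem_patterns.
- by move=> u v w uv vw uw; have := cH _ _ _ _ _ _ uv vw uw; rewrite
    mem_patterns.
- move=> A col A_col; apply: leq_bigmax_cond.
  by apply/two_colored_card; exists col.
Qed.

Lemma h2_lower (n : nat) : n ^ 2 <= 16 * h2 n [:: rrb; bby; rby] ^ 3.
Proof.
apply: (big_ind (fun h => n ^ 2 <= 16 * h ^ 3)) => [|x y hx hy|c].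
(* The unit [n] of the minimum must satisfy the bound too. *)
- by case: n => // n; rewrite (expnS _ 2) mulnCA; nia.
- by rewrite /minn; case: ifP.
- exact: h2_coloring_lower.
Qed.

(** * The upper bound: a lexicographic coloring of a cube *)

Lemma h2_upper (m n : nat) : n <= m ^ 3 -> h2 n [:: rrb; bby; rby] <= m ^ 2.
Proof.
move=> le_n_m.
have le_card : n <= #|{: 'I_m * 'I_m * 'I_m}| by rewrite !card_prod card_ord
  mulnn -expnSr.
pose x (u : 'I_n) := enum_val (widen_ord le_card u).
have x_inj : injective x.
  by move=> u v /enum_val_inj/(congr1 val)/= /val_inj.
(* Edges are unordered, so agreement in a coordinate is stated by quantifying over both ends. *)
pose c : coloring n := [ffun e : edge n =>
  if [forall u in val e, forall v in val e, (x u).1.1 == (x v).1.1] then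
    if [forall u in val e, forall v in val e, (x u).1.2 == (x v).1.2] then Red
    else Blue
  else Yellow].
have allE (f : 'I_n -> 'I_m) u v :
    [forall s in [set u; v], forall t in [set u; v], f s == f t] = (f u == f v).
  apply/forall_inP/idP => [/(_ u (finset.set21 _ _))/forall_inP/(_ v
    (finset.set22 _ _)) // | /eqP fE s].
  rewrite !inE => /orP[] /eqP->; apply/forall_inP => t; rewrite !inE => /orP[]
    /eqP->;
    by rewrite ?fE.
have cE u v a : pair_color c u v = Some a ->
    u != v /\ a = (if (x u).1.1 == (x v).1.1 then
             if (x u).1.2 == (x v).1.2 then Red else Blue else Yellow).
  move=> /pair_colorP[neq [e eE <-]]; split=> //.
  by rewrite ffunE eE (allE (fun u => (x u).1.1)) (allE (fun u => (x u).1.2)).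
have cE' u v : u != v -> pair_color c u v = Some (if (x u).1.1 == (x v).1.1 then
             if (x u).1.2 == (x v).1.2 then Red else Blue else Yellow).
  rewrite -(pair_color_eq c); case cuv : (pair_color c u v) => [a|] // _.
  by have [_ ->] := cE _ _ _ cuv.
apply: leq_trans (bigmin_leq (i := c) _ _ _) _.
  apply/ForbP => u v w a b d /cE[_ ->] /cE[_ ->] /cE[_ ->].
  rewrite mem_patterns.
  (* Agreement in the first coordinate, and in the first two, is transitive; this excludes all three
     patterns. *)
  by do ![case: eqP => ?]; first [done | exfalso; congruence].
apply/bigmax_leqP => S /two_colored_card[col S_col].
rewrite -mulnn -{1 2}[m]card_ord -card_prod.
(* Injective coordinate pairs: first and second without red, first and third without blue, second
   and third without yellow. *)
case: col S_col => S_col.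
- apply: (@leq_card_in _ _ (fun u => ((x u).1.1, (x u).1.2))) => u v uS vS [e1
    e2].
  have [//|/cE' E] := eqVneq u v.
  by have := S_col u v uS vS; rewrite E e1 e2 !eqxx.
- apply: (@leq_card_in _ _ (fun u => ((x u).1.1, (x u).2))) => u v uS vS [e1
    e3].
  have [//|/cE' E] := eqVneq u v.
  have := S_col u v uS vS; rewrite E e1 eqxx.
  case: ((x u).1.2 =P (x v).1.2) => [e2 _|_ /eqP //].
  apply: x_inj; move: (x u) (x v) e1 e2 e3 => [[? ?] ?] [[? ?] ?] /=.
  by move=> -> -> ->.
- apply: (@leq_card_in _ _ (fun u => ((x u).1.2, (x u).2))) => u v uS vS [e2
    e3].
  have [//|/cE' E] := eqVneq u v.
  have := S_col u v uS vS; rewrite E.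
  case: ((x u).1.1 =P (x v).1.1) => [e1 _|_ /eqP //].
  apply: x_inj; move: (x u) (x v) e1 e2 e3 => [[? ?] ?] [[? ?] ?] /=.
  by move=> -> -> ->.
Qed.

(** * Asymptotics over the reals *)

Local Open Scope classical_set_scope.
Local Open Scope ring_scope.

Theorem lemma3p7 (R : realType) :
  (fun n : nat => (h2 n [:: rrb; bby; rby])%:R : R)
    \is 'Theta_\oo (fun n : nat => (n%:R : R) `^ (2%:R / 3%:R)).
Proof.
(* After cubing, the constants come from n^2 <= 16h^3 <= (4h)^3 and h^3 <= 64n^2 = 4^3 n^2. *)
apply/asboolP; exists (1 / 4, 4) => /=; first by rewrite divr_gt0 ?ltr0n.
apply: nearW => n; set h := h2 n _; set x : R := _ `^ _.
have x_ge0 : 0 <= x by exact: powR_ge0.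
have h_ge0 : 0 <= h%:R :> R by [].
have x3 : x ^+ 3 = (n ^ 2)%N%:R.
  by rewrite -powR_mulrn // -powRrM divfK ?pnatr_eq0 // powR_mulrn // natrX.
have lower : (n ^ 2)%N%:R <= 16 * h%:R ^+ 3 :> R.
  by rewrite -natrX -natrM ler_nat h2_lower.
have upper : h%:R ^+ 3 <= 64 * (n ^ 2)%N%:R :> R.
  rewrite -natrX -natrM ler_nat.
  have [m /andP[le_n_m le_m_n]] := ceil_root n (isT : (0 < 3)%N).
  (* From h <= m^2 and m^3 <= 8n: h^3 <= m^6 <= 64n^2. *)
  apply: (@leq_trans ((m ^ 2) ^ 3)%N); first by rewrite leq_exp2r // h2_upper.
  by rewrite -expnM mulnC expnM -[64%N]/((2 ^ 3) ^ 2)%N -expnMn leq_exp2r.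
rewrite !ger0_norm //; split.
  rewrite div1r ler_pdivrMl ?ltr0n // -(@ler_pXn2r _ 3) ?nnegrE ?mulr_ge0 //.
  rewrite x3 exprMn (le_trans lower) // ler_wpM2r ?exprn_ge0 //.
  by rewrite -natrX ler_nat.
rewrite -(@ler_pXn2r _ 3) ?nnegrE ?mulr_ge0 // exprMn x3 (le_trans upper) //.
by rewrite -natrX.
Qed.
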